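(* Let $f:\mathbb{R}\to\mathbb{R}$ be a $C^2$ function. The surfaces $\Sigma=\{(a,\rho):a=f(\rho)\}$ in the affine-additive group $\mathcal{AA}$ that have constant horizontal mean curvature $H^h_\Sigma=h$ are the following: (1) the families defined by $$f(\rho)=\frac12\left(\pm\arctan\left(\sqrt{\frac{\rho^2+c}{1-c}}\right)+\arctan(\rho)\right)+C,\qquad c\in(0,1),\ C\in\mathbb{R},$$ and $$f(\rho)=\frac12\arctan(\rho)+C,\qquad C\in\mathbb{R},$$ if $h=0$; (2) the two-parameter family of surfaces defined by $$f(\rho)=\frac{\arctan\rho}{2}\pm\frac12\arccos\left(\frac{A(\rho)}{\sqrt{\rho^2+1}}\right)+g(\rho),$$ where $$g(\rho)=\begin{cases} \mp\dfrac{\sqrt{1-c_1^2+2c_1\rho}}{2c_1}+C_1, & \text{if } h=2,\\[2mm] \mp\dfrac{\sqrt{1-c_1^2-2c_1\rho}}{2c_1}+C_2, & \text{if } h=-2,\\[2mm] \mp\dfrac h4\dfrac1{\sqrt\alpha}\,\mathrm{arcsinh}\left(\dfrac{\sigma}{\sqrt{\Delta/\alpha}}\right)+c_3, & \text{if }\alpha>0\text{ and }\Delta>0,\\[2mm] \mp\dfrac h4\dfrac1{\sqrt\alpha}\,\mathrm{arcosh}\left(\dfrac{|\sigma|}{\sqrt{|\Delta|/\alpha}}\right)+c_4, & \text{if }\alpha>0,\ \Delta<0\text{ and }|\sigma|>\sqrt{|\Delta|/\alpha},\\[2mm] \mp\dfrac h4\dfrac1{\sqrt\alpha}\ln\left(|\sigma|\right)+c_5,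 & \text{if }\alpha>0,\ \Delta=0\text{ and }\sigma\neq0,\\[2mm] \mp\dfrac h4\dfrac1{\sqrt{-\alpha}}\arcsin\left(\dfrac{\sigma\sqrt{-\alpha}}{\sqrt\Delta}\right)+c_6, & \text{if }\alpha<0,\ \Delta>0\text{ and }|\sigma|<\sqrt{-\Delta/\alpha}. \end{cases}$$ Here $A(\rho)=-\frac h2\rho+c_1$, $\alpha=1-\frac{h^2}{4}$, $\beta=c_1h$, $\gamma=1-c_1^2$, $\sigma=\rho+\frac{\beta}{2\alpha}$ and $\Delta=\gamma-\frac{\beta^2}{4\alpha}$, for $\alpha\neq0$; $c_1,C_1,C_2,c_3,c_4,c_5,c_6$ are constants, and $c_1$ and $\rho\neq0$ satisfy $$\sqrt{\rho^2+1}>\left|c_1-\frac h2\rho\right|.$$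
   Context: The affine-additive group $\mathcal{AA}$ is $\{(a,\lambda,t):a\in\mathbb{R},\lambda>0,t\in\mathbb{R}\}$ with group law $(a,\lambda,t)\cdot(a',\lambda',t')=(a+a',\lambda\lambda',\lambda t'+t)$. Its left-invariant frame is $V=2\lambda\,\partial_\lambda$, $U=\partial_a+2\lambda\,\partial_t$, $W=-\partial_a$, with $[V,U]=2(U+W)$ the only non-vanishing bracket; the horizontal distribution is spanned by the orthonormal fields $V,U$. For a surface $\Sigma=\{u=0\}$ with $C^2$ defining function $u$, put $\|\nabla_Hu\|=\sqrt{(Vu)^2+(Uu)^2}$. At non-characteristic points (those where $\|\nabla_Hu\|\neq0$) the horizontal mean curvature is $$H^h_\Sigma=V\left(\frac{Vu}{\|\nabla_Hu\|}\right)+U\left(\frac{Uu}{\|\nabla_Hu\|}\right)-2\frac{Vu}{\|\nabla_Hu\|}.$$ The surfaces $\Sigma=\{(a,\rho):a=f(\rho)\}$ are the surfaces of revolution $u=a-f(\rho)=0$ with $\rho=t/\lambda$ (invariant under $(a,\lambda,t)\mapsto(a,\delta\lambda,\delta t)$, $\delta>0$); their characteristic points are the points with $\rho=0$ and $f'(0)=\frac12$.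
   Formalization: Corrected: f=C and f=arctan ρ+C added to (1); for h=±2, c_1=0, g is ∓(h/4)ρ+C; factor sgn(σ) added in the arcosh and ln cases; ± is the sign of ρ for curvature h (opposite sign gives −h); constants may differ on the two sides of ρ=0; (2) is stated on open intervals. *)

(* Defs.v *)
From Stdlib Require Import Reals.
From Coquelicot Require Export Coquelicot.
Open Scope R_scope.

(* A point of the group is (a, lambda, t) with 0 < lambda.  Functions on the
   group are represented by total functions R -> R -> R -> R; only their values
   on the open half-space 0 < lambda matter. *)

Definition V (u : R -> R -> R -> R) (a l t : R) : R :=
  2 * l * Derive (fun l' => u a l' t) l.

Definition U (u : R -> R -> R -> R) (a l t : R) : R :=
  Derive (fun a' => u a' l t) a + 2 * l * Derive (fun t' => u a l t') t.

Definition norm_gradH (u : R -> R -> R -> R) (a l t : R) : R :=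
  sqrt (V u a l t ^ 2 + U u a l t ^ 2).

(* The horizontal mean curvature; meaningful where [norm_gradH] is nonzero. *)
Definition Hmean (u : R -> R -> R -> R) (a l t : R) : R :=
  V (fun a' l' t' => V u a' l' t' / norm_gradH u a' l' t') a l t
  + U (fun a' l' t' => U u a' l' t' / norm_gradH u a' l' t') a l t
  - 2 * (V u a l t / norm_gradH u a l t).

Definition urev (f : R -> R) (a l t : R) : R := a - f (t / l).

Definition itv (lo hi : Rbar) (x : R) : Prop := Rbar_lt lo x /\ Rbar_lt x hi.

Definition C2_on (D : R -> Prop) (f : R -> R) : Prop :=
  forall x : R, D x ->
    ex_derive f x /\ ex_derive (Derive f) x /\ continuous (Derive (Derive f)) x.

(* The part of the surface a = f(rho), rho = t / lambda, lying over rho in D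
   has horizontal mean curvature h at each of its non-characteristic points. *)
Definition const_Hmean (D : R -> Prop) (f : R -> R) (h : R) : Prop :=
  forall a l t : R, 0 < l -> D (t / l) -> urev f a l t = 0 ->
    norm_gradH (urev f) a l t <> 0 -> Hmean (urev f) a l t = h.

Definition is_sign (s : R) : Prop := s = 1 \/ s = -1.

(* The last clause is the member c = 0 of the first one: there
   sqrt (rho^2) = |rho|, and the sign has to change at rho = 0 for f to be C^2,
   which leaves s * atan rho.  These are the surfaces f = C and
   f = atan + C, which have no characteristic points. *)
Definition minimal_profile (f : R -> R) : Prop :=
  (exists s c C : R, is_sign s /\ 0 < c < 1 /\
     forall rho : R,
       f rho = / 2 * (s * atan (sqrt ((rho ^ 2 + c) / (1 - c))) + atan rho) + C)
  \/ (exists C : R, forall rho : R, f rho = / 2 * atan rho + C)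
  \/ (exists s C : R, is_sign s /\
        forall rho : R, f rho = / 2 * (s * atan rho + atan rho) + C).

(* The inverse of cosh on [1, +oo), as [arcsinh] is defined in [Rpower]. *)
Definition arcosh (x : R) : R := ln (x + sqrt (x ^ 2 - 1)).

Definition Afun (h c1 rho : R) : R := - (h / 2) * rho + c1.
Definition alpha (h : R) : R := 1 - h ^ 2 / 4.
Definition beta (h c1 : R) : R := c1 * h.
Definition gamma (c1 : R) : R := 1 - c1 ^ 2.
Definition sigma (h c1 rho : R) : R := rho + beta h c1 / (2 * alpha h).
Definition Delta (h c1 : R) : R := gamma c1 - beta h c1 ^ 2 / (4 * alpha h).

(* [g_branch s h c1 D g]: on D, g is one of the listed summands, s being the
   sign written +/- in front of arccos (so that -/+ is - s).  Up to the factor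
   - s * h / 4, g is a primitive of
     / sqrt (alpha rho^2 + beta rho + gamma) = / sqrt (alpha sigma^2 + Delta).
   - The factor [sign sigma] in the arcosh and ln branches is needed because
     the derivatives of arcosh |sigma| and ln |sigma| change sign with sigma.
   - The branches h = 2 and h = -2 divide by c1; [g_lin] is the case c1 = 0,
     in which alpha = beta = 0 and gamma = 1. *)
Inductive g_branch (s h c1 : R) (D : R -> Prop) (g : R -> R) : Prop :=
| g_plus2 (C : R) :
    h = 2 -> c1 <> 0 ->
    (forall rho, D rho ->
       g rho = - s * (sqrt (1 - c1 ^ 2 + 2 * c1 * rho) / (2 * c1)) + C) ->
    g_branch s h c1 D g
| g_minus2 (C : R) :
    h = -2 -> c1 <> 0 ->
    (forall rho, D rho ->
       g rho = - s * (sqrt (1 - c1 ^ 2 - 2 * c1 * rho) / (2 * c1)) + C) ->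
    g_branch s h c1 D g
| g_lin (C : R) :
    h = 2 \/ h = -2 -> c1 = 0 ->
    (forall rho, D rho -> g rho = - s * (h / 4) * rho + C) ->
    g_branch s h c1 D g
| g_arcsinh (C : R) :
    0 < alpha h -> 0 < Delta h c1 ->
    (forall rho, D rho ->
       g rho = - s * (h / 4) * / sqrt (alpha h) *
                 arcsinh (sigma h c1 rho / sqrt (Delta h c1 / alpha h)) + C) ->
    g_branch s h c1 D g
| g_arcosh (C : R) :
    0 < alpha h -> Delta h c1 < 0 ->
    (forall rho, D rho ->
       Rabs (sigma h c1 rho) > sqrt (Rabs (Delta h c1) / alpha h) /\
       g rho = - s * (h / 4) * / sqrt (alpha h) * sign (sigma h c1 rho) *
                 arcosh (Rabs (sigma h c1 rho) /
                         sqrt (Rabs (Delta h c1) / alpha h)) + C) ->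
    g_branch s h c1 D g
| g_ln (C : R) :
    0 < alpha h -> Delta h c1 = 0 ->
    (forall rho, D rho ->
       sigma h c1 rho <> 0 /\
       g rho = - s * (h / 4) * / sqrt (alpha h) * sign (sigma h c1 rho) *
                 ln (Rabs (sigma h c1 rho)) + C) ->
    g_branch s h c1 D g
| g_arcsin (C : R) :
    alpha h < 0 -> 0 < Delta h c1 ->
    (forall rho, D rho ->
       Rabs (sigma h c1 rho) < sqrt (- Delta h c1 / alpha h) /\
       g rho = - s * (h / 4) * / sqrt (- alpha h) *
                 asin (sigma h c1 rho * sqrt (- alpha h) / sqrt (Delta h c1))
               + C) ->
    g_branch s h c1 D g.

(* Membership of f, over D, in the two-parameter family with the sign s. *)
Definition cmc_profile (s h : R) (D : R -> Prop) (f : R -> R) : Prop :=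
  exists (c1 : R) (g : R -> R),
    g_branch s h c1 D g /\
    forall rho : R, D rho ->
      sqrt (rho ^ 2 + 1) > Rabs (c1 - h / 2 * rho) /\
      f rho = atan rho / 2
              + s * (/ 2 * acos (Afun h c1 rho / sqrt (rho ^ 2 + 1)))
              + g rho.

(* Main.v *)
Require Import Defs.
From Stdlib Require Import Reals.
From Coquelicot Require Import Coquelicot.
From Stdlib Require Import Lra Psatz Classical_Prop.
Open Scope R_scope.

(** The horizontal gradient of u = a - f(rho) is (X, Y) = (2 rho f', 1 - 2 f'), a
    function of rho alone, and on such functions the frame acts as
    V = -2 rho d/drho and U = 2 d/drho.  The curvature is therefore a total
    derivative, H = 2 (flux)' with flux = (Y - rho X) / |(X, Y)| ([Hmean_urev]), and
    H = e h says that the flux is e h rho / 2 + const wherever rho is not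
    characteristic.

    Away from rho = 0 the flux determines f' algebraically ([flux_slope]): the flux is
    - e A exactly when A^2 < 1 + rho^2 and
      f' = (1 + s A rho / sqrt (1 + rho^2 - A^2)) / (2 (1 + rho^2)),
    s being the sign of e rho.  So constant curvature means that on each side
    of 0 this holds with A = - h rho / 2 + c1, for a constant c1 that depends on the
    side ([const_Hmean_slopes]).  At rho = 0, either
    the point is characteristic, or the flux is continuous there and the two affine
    functions coincide.

    The two-parameter family consists of the primitives of these slopes.
    Differentiating arccos (A / sqrt (1 + rho^2)) produces the slope plus the term
    s (h / 4) / sqrt (1 + rho^2 - A^2), and the branches g are the primitives of minus that
    term, found by completing the square in
    1 + rho^2 - A^2 = alpha rho^2 + beta rho + gamma ([g_branch_derive],
    [cmc_profile_slopes]).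

    For h = 0 and f of class C^2 on the whole line, A is constant on each side, of absolute
    value at most 1, and the differentiability of f' at 0 ties the two constants
    together, which leaves the minimal profiles ([minimal_profile_of_slopes]). *)

(** * Functions with vanishing derivative and one-sided germs *)

(** Equations produced by extensionality lemmas live in the carrier of a normed
    module; [ring] and [field] need them stated in [R]. *)
Ltac real_eq := lazymatch goal with |- @eq _ ?a ?b => change (@eq R a b) end;
  cbv beta.

Lemma null_derivative_const (D : R -> Prop) (F : R -> R) :
  (forall x y z, D x -> D y -> x <= z <= y -> D z) ->
  (forall x, D x -> is_derive F x 0) ->
  forall x y, D x -> D y -> F x = F y.
Proof.
intros Hc HF x y Dx Dy.
assert (HD : forall z, Rmin x y <= z <= Rmax x y -> D z).
{ intros z Hz; unfold Rmin, Rmax in Hz; destruct (Rle_dec x y).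
  - now apply (Hc x y).
  - now apply (Hc y x). }
destruct (MVT_gen F x y (fun _ => 0)) as [c [_ Hcc]].
- intros z Hz; apply HF, HD; lra.
- intros z Hz; apply continuity_pt_filterlim.
  apply (ex_derive_continuous F); exists 0; now apply HF, HD.
- lra.
Qed.

(** Because F is continuous at x0, the mean value theorem applies on the closed
    segment from x0 to a nearby point and shows that the constants on the two
    sides of x0 both equal F x0.  This is how the curvature equation passes
    through rho = 0 when that point is not characteristic. *)
Lemma null_derivative_punctured (F : R -> R) (x0 : R) :
  continuous F x0 ->
  locally x0 (fun x => x <> x0 -> is_derive F x 0) ->
  is_derive F x0 0.
Proof.
intros HF [eps Heps].
apply (is_derive_ext_loc (fun _ => F x0)); [|apply @is_derive_const].
exists eps; intros y Hy; change (Rabs (y - x0) < eps) in Hy.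
assert (Hb : forall z, Rmin x0 y <= z <= Rmax x0 y -> Rabs (z - x0) < eps).
{ intros z Hz; revert Hy; unfold Rmin, Rmax in Hz; unfold Rabs.
  destruct (Rle_dec x0 y); repeat destruct Rcase_abs; lra. }
destruct (MVT_gen F x0 y (fun _ => 0)) as [c [_ Hcc]].
- intros z Hz; apply Heps; [apply Hb; lra|].
  unfold Rmin, Rmax in Hz; destruct (Rle_dec x0 y); lra.
- intros z Hz; apply continuity_pt_filterlim.
  destruct (Req_dec z x0) as [->|Hz0]; [exact HF|].
  apply (ex_derive_continuous F); exists 0; apply Heps; [now apply Hb|easy].
- lra.
Qed.

(** The next two lemmas read off, from the values on the right of 0 only, the
    value and the derivative at 0; applied to a difference they say that two
    functions which agree for x > 0 have the same first-order jet at 0. *)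
Lemma right_germ_value (F : R -> R) :
  continuous F 0 -> (forall x, 0 < x -> F x = 0) -> F 0 = 0.
Proof.
intros HF Hx; destruct (Req_dec (F 0) 0) as [?|Hn]; [easy|exfalso].
assert (He : 0 < Rabs (F 0)) by now apply Rabs_pos_lt.
destruct (proj1 (filterlim_locally F (F 0)) HF (mkposreal _ He)) as [d Hd].
assert (Hd0 := cond_pos d).
assert (Hb : ball 0 d (d / 2)).
{ change (Rabs (d / 2 - 0) < d); rewrite Rabs_pos_eq; lra. }
specialize (Hd _ Hb); cbv beta in Hd; rewrite Hx in Hd by lra.
change (Rabs (0 - F 0) < Rabs (F 0)) in Hd; rewrite Rminus_0_l, Rabs_Ropp in Hd; lra.
Qed.

Lemma right_germ_derive (F : R -> R) (l : R) :
  is_derive F 0 l -> (forall x, 0 < x -> F x = 0) -> l = 0.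
Proof.
intros HF Hx.
assert (H0 : F 0 = 0).
{ apply right_germ_value; [apply (ex_derive_continuous F); now exists l|easy]. }
destruct (Req_dec l 0) as [?|Hn]; [easy|exfalso].
assert (He : 0 < Rabs l) by now apply Rabs_pos_lt.
destruct (proj1 (is_derive_Reals _ _ _) HF _ He) as [d Hd].
assert (Hd0 := cond_pos d).
specialize (Hd (d / 2)); rewrite Rplus_0_l, H0, Hx in Hd by lra.
assert (Hlt : Rabs ((0 - 0) / (d / 2) - l) < Rabs l).
{ apply Hd; [lra|rewrite Rabs_pos_eq; lra]. }
replace ((0 - 0) / (d / 2) - l) with (- l) in Hlt by (field; lra).
rewrite Rabs_Ropp in Hlt; lra.
Qed.

(** * The curvature of a surface of revolution as a derivative *)

Definition grad_norm (r p : R) : R := sqrt ((2 * r * p) ^ 2 + (1 - 2 * p) ^ 2).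

(** With (X, Y) = (2 rho p, 1 - 2 p) the horizontal gradient of a - f(rho), where
    p = f'(rho), this is (Y - rho X) / |(X, Y)|. *)
Definition flux (r p : R) : R := (1 - 2 * (1 + r ^ 2) * p) / grad_norm r p.

(** On functions of rho = t / lambda the frame acts as V = -2 rho d/drho and
    U = 2 d/drho.  The term k * a and the predicate P allow one statement to
    serve both the defining function (k = 1) and the normalised gradient
    (k = 0), which is a function of rho only where f is differentiable. *)
Lemma frame_of_rho (F : R -> R -> R -> R) (phi : R -> R) (P : R -> Prop)
    (k a l t d : R) :
  0 < l -> locally (t / l) P ->
  (forall a' l' t', 0 < l' -> P (t' / l') -> F a' l' t' = k * a' + phi (t' / l')) ->
  is_derive phi (t / l) d ->
  V F a l t = - 2 * (t / l) * d /\ U F a l t = k + 2 * d.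
Proof.
intros Hl HP HF Hd.
assert (HVd : is_derive (fun l' => t / l') l (- t / l ^ 2)).
{ auto_derive; [lra|field; lra]. }
assert (HUd : is_derive (fun t' => t' / l) t (/ l)).
{ auto_derive; [easy|field; lra]. }
assert (Hl' : locally l (fun l' => 0 < l')) by now apply (open_gt 0).
assert (HV : is_derive (fun l' => F a l' t) l (- t / l ^ 2 * d)).
{ apply (is_derive_ext_loc (fun l' => k * a + phi (t / l'))).
  - assert (Hc : continuous (fun l' => t / l') l)
      by (apply (ex_derive_continuous (fun l' => t / l')); eexists; exact HVd).
    specialize (Hc _ HP).
    generalize (filter_and _ _ Hl' Hc); apply filter_imp.
    intros y [Hy1 Hy2]; now rewrite HF.
  - replace (- t / l ^ 2 * d) with (0 + scal (- t / l ^ 2) d)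
      by (unfold scal; simpl; unfold mult; simpl; ring).
    apply @is_derive_plus; [apply @is_derive_const|].
    now apply (is_derive_comp phi (fun l' => t / l')). }
assert (HUa : is_derive (fun a' => F a' l t) a k).
{ apply (is_derive_ext (fun a' => k * a' + phi (t / l))).
  - intro y; rewrite HF; [easy|easy|now apply locally_singleton].
  - auto_derive; [easy|ring]. }
assert (HUt : is_derive (fun t' => F a l t') t (/ l * d)).
{ apply (is_derive_ext_loc (fun t' => k * a + phi (t' / l))).
  - assert (Hc : continuous (fun t' => t' / l) t)
      by (apply (ex_derive_continuous (fun t' => t' / l)); eexists; exact HUd).
    specialize (Hc _ HP).
    unfold filtermap in Hc; generalize Hc; apply filter_imp.
    intros y Hy2; now rewrite HF.
  - replace (/ l * d) with (0 + scal (/ l) d)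
      by (unfold scal; simpl; unfold mult; simpl; ring).
    apply @is_derive_plus; [apply @is_derive_const|].
    now apply (is_derive_comp phi (fun t' => t' / l)). }
unfold V, U.
replace (Derive (fun l' => F a l' t) l) with (- t / l ^ 2 * d)
  by (symmetry; now apply is_derive_unique).
replace (Derive (fun a' => F a' l t) a) with k
  by (symmetry; now apply is_derive_unique).
replace (Derive (fun t' => F a l t') t) with (/ l * d)
  by (symmetry; now apply is_derive_unique).
split; field; lra.
Qed.

Lemma frame_urev (f : R -> R) (a l t : R) :
  0 < l -> ex_derive f (t / l) ->
  V (urev f) a l t = 2 * (t / l) * Derive f (t / l)
  /\ U (urev f) a l t = 1 - 2 * Derive f (t / l).
Proof.
intros Hl Hf.
destruct (frame_of_rho (urev f) (fun r => - f r) (fun _ => True) 1 a l t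
  (- Derive f (t / l))) as [-> ->].
- easy.
- now apply filter_forall.
- intros; unfold urev; ring.
- apply @is_derive_opp; now apply Derive_correct.
- split; ring.
Qed.

Lemma norm_gradH_urev (f : R -> R) (a l t : R) :
  0 < l -> ex_derive f (t / l) ->
  norm_gradH (urev f) a l t = grad_norm (t / l) (Derive f (t / l)).
Proof.
intros Hl Hf; unfold norm_gradH, grad_norm.
now destruct (frame_urev f a l t Hl Hf) as [-> ->].
Qed.

Lemma grad_norm_pos_sqr (r p : R) :
  grad_norm r p <> 0 -> 0 < (2 * r * p) ^ 2 + (1 - 2 * p) ^ 2.
Proof.
intro H; destruct (Rle_lt_dec ((2 * r * p) ^ 2 + (1 - 2 * p) ^ 2) 0) as [Hl|]; [|easy].
destruct H; now apply sqrt_neg_0.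
Qed.

Lemma ex_derive_over_norm (num : R -> R) (p : R -> R) (r : R) :
  ex_derive num r -> ex_derive p r -> grad_norm r (p r) <> 0 ->
  ex_derive (fun r => num r / grad_norm r (p r)) r.
Proof.
intros Hn Hp H0; unfold grad_norm in *.
assert (H1 := grad_norm_pos_sqr _ _ H0).
apply ex_derive_div; [easy| |easy].
auto_derive.
repeat split; try easy.
Qed.

(** The frame turns H into -2 rho (X/N)' + 2 (Y/N)' - 2 X/N, and the
    zeroth-order term is what makes this the exact derivative
    2 ((Y - rho X) / N)'. *)
Lemma Hmean_urev (f : R -> R) (a l t : R) :
  0 < l -> locally (t / l) (ex_derive f) -> ex_derive (Derive f) (t / l) ->
  grad_norm (t / l) (Derive f (t / l)) <> 0 ->
  Hmean (urev f) a l t = 2 * Derive (fun r => flux r (Derive f r)) (t / l).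
Proof.
intros Hl Hloc H2 HN.
set (p := Derive f) in *; set (r0 := t / l) in *.
set (X := fun r => 2 * r * p r / grad_norm r (p r)).
set (Y := fun r => (1 - 2 * p r) / grad_norm r (p r)).
assert (HX : ex_derive X r0).
{ apply (ex_derive_over_norm (fun r => 2 * r * p r)); try easy.
  auto_derive; easy. }
assert (HY : ex_derive Y r0).
{ apply (ex_derive_over_norm (fun r => 1 - 2 * p r)); try easy.
  auto_derive; easy. }
destruct (frame_of_rho
  (fun a' l' t' => V (urev f) a' l' t' / norm_gradH (urev f) a' l' t')
  X (ex_derive f) 0 a l t (Derive X r0)) as [HV _]; [easy|easy| | |].
{ intros a' l' t' Hl' Hf'; rewrite norm_gradH_urev by easy.
  destruct (frame_urev f a' l' t' Hl' Hf') as [-> _]; unfold X, p; ring. }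
{ now apply Derive_correct. }
destruct (frame_of_rho
  (fun a' l' t' => U (urev f) a' l' t' / norm_gradH (urev f) a' l' t')
  Y (ex_derive f) 0 a l t (Derive Y r0)) as [_ HU]; [easy|easy| | |].
{ intros a' l' t' Hl' Hf'; rewrite norm_gradH_urev by easy.
  destruct (frame_urev f a' l' t' Hl' Hf') as [_ ->]; unfold Y, p; ring. }
{ now apply Derive_correct. }
unfold Hmean; rewrite HV, HU.
assert (Hf0 : ex_derive f (t / l)) by now apply locally_singleton.
rewrite norm_gradH_urev by easy.
destruct (frame_urev f a l t Hl Hf0) as [-> _].
assert (HD : is_derive (fun r => flux r (p r)) r0 (Derive Y r0 - (X r0 + r0 * Derive X r0))).
{ apply (is_derive_ext (fun r => Y r - r * X r)).
  - intro r; change (Y r - r * X r = flux r (p r) :> R); unfold X, Y, flux, Rdiv; ring.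
  - auto_derive; [easy|].
    change (Derive (fun x => Y x) r0) with (Derive Y r0).
    change (Derive (fun x => X x) r0) with (Derive X r0). ring. }
replace (Derive (fun r => flux r (p r)) r0) with (Derive Y r0 - (X r0 + r0 * Derive X r0))
  by (symmetry; now apply is_derive_unique).
fold r0; fold p. change (2 * r0 * p r0 / grad_norm r0 (p r0)) with (X r0). fold r0. field.
Qed.

(** The derivative of a profile whose flux is A up to sign; see [flux_slope]. *)
Definition slope (s A r : R) : R :=
  (1 + s * (A * r / sqrt (1 + r ^ 2 - A ^ 2))) / (2 * (1 + r ^ 2)).

Lemma grad_norm_pos (r p : R) : r <> 0 -> 0 < grad_norm r p.
Proof.
intro Hr; apply sqrt_lt_R0.
assert (0 < r ^ 2) by (apply pow2_gt_0; easy).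
destruct (Req_dec p 0) as [->|Hp]; [lra|].
assert (0 < p ^ 2) by (apply pow2_gt_0; easy).
assert (0 <= (1 - 2 * p) ^ 2) by apply pow2_ge_0.
nra.
Qed.

(** Put q = 1 + r^2 and w = 2 q p - 1.  Then the flux is - w / N and
    q N^2 = w^2 + r^2.  Hence flux^2 < q away from r = 0, and N can be eliminated:
    q - A^2 = (r / N)^2, which gives w = s A r / sqrt (q - A^2).  The sign s of
    e r decides which square root of (r / N)^2 occurs. *)
Lemma flux_slope (e s r p A : R) :
  is_sign e -> is_sign s -> 0 < e * s * r ->
  flux r p = - e * A <-> A ^ 2 < 1 + r ^ 2 /\ p = slope s A r.
Proof.
intros He Hs Hr.
assert (He2 : e * e = 1) by (destruct He as [-> | ->]; ring).
assert (Hs2 : s * s = 1) by (destruct Hs as [-> | ->]; ring).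
assert (Hr0 : r <> 0) by (intros ->; lra).
assert (Hr2 : 0 < r ^ 2) by now apply pow2_gt_0.
assert (HN := grad_norm_pos r p Hr0).
assert (HN2 : grad_norm r p * grad_norm r p = (2 * r * p) ^ 2 + (1 - 2 * p) ^ 2).
{ apply sqrt_sqrt; generalize (pow2_ge_0 (2 * r * p)) (pow2_ge_0 (1 - 2 * p)); lra. }
unfold flux; set (N := grad_norm r p) in *.
set (w := 2 * (1 + r ^ 2) * p - 1).
assert (Hp : p = (1 + w) / (2 * (1 + r ^ 2))) by (unfold w; field; nra).
assert (HNw : N * N * (1 + r ^ 2) = w ^ 2 + r ^ 2).
{ rewrite HN2; unfold w; ring. }
replace (1 - 2 * (1 + r ^ 2) * p) with (- w) by (unfold w; ring).
unfold slope; rewrite Hp at 1. clearbody N w. split.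
- intro HA.
  assert (HA' : A = e * w / N).
  { replace A with (e * e * A) by (rewrite He2; ring).
    replace (e * e * A) with (- e * (- e * A)) by ring.
    rewrite <- HA; field; lra. }
  assert (HR : 1 + r ^ 2 - A ^ 2 = (e * s * r / N) ^ 2).
  { rewrite HA'; replace ((e * w / N) ^ 2) with (e * e * w ^ 2 / N ^ 2) by (field; lra).
    replace ((e * s * r / N) ^ 2) with ((e * e) * (s * s) * r ^ 2 / N ^ 2) by (field; lra).
    rewrite He2, Hs2; apply Rmult_eq_reg_r with (N ^ 2); [|nra].
    field_simplify; [|lra|lra]. nra. }
  assert (Hpos : 0 < e * s * r / N) by now apply Rdiv_lt_0_compat.
  rewrite HR, sqrt_pow2 by lra.
  split; [nra|].
  replace (s * (A * r / (e * s * r / N))) with w; [easy|].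
  rewrite HA'; field; repeat split; try lra; intros ->; lra.
- intros [HA Hw].
  set (R0 := sqrt (1 + r ^ 2 - A ^ 2)) in *.
  assert (HR0 : 0 < R0) by (apply sqrt_lt_R0; lra).
  assert (HR2 : R0 * R0 = 1 + r ^ 2 - A ^ 2) by (apply sqrt_sqrt; lra).
  assert (Hw' : w = s * (A * r / R0)).
  { apply (f_equal (fun x => x * (2 * (1 + r ^ 2)) - 1)) in Hw.
    revert Hw. replace ((1 + w) / (2 * (1 + r ^ 2)) * (2 * (1 + r ^ 2)) - 1) with w
      by (field; lra).
    intros ->; field; split; lra. }
  assert (HNr : N = e * s * r / R0).
  { apply Rsqr_inj; [lra|apply Rlt_le; now apply Rdiv_lt_0_compat|].
    unfold Rsqr; apply Rmult_eq_reg_r with (1 + r ^ 2); [|lra].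
    rewrite HNw, Hw'.
    replace ((s * (A * r / R0)) ^ 2) with (s * s * A ^ 2 * r ^ 2 / (R0 * R0)) by (field; lra).
    replace (e * s * r / R0 * (e * s * r / R0)) with (e * e * (s * s) * r ^ 2 / (R0 * R0))
      by (field; lra).
    rewrite He2, Hs2, HR2; field; lra. }
  rewrite HNr, Hw'.
  apply Rmult_eq_reg_l with e; [|intros ->; lra].
  replace (e * (- e * A)) with (- (e * e) * A) by ring.
  rewrite He2; field; repeat split; try lra; intros ->; lra.
Qed.

(** * The curvature equation integrated once *)

Lemma itv_open (lo hi : Rbar) (x : R) : itv lo hi x -> locally x (itv lo hi).
Proof.
intros [Hlo Hhi]; apply filter_and.
- now apply open_Rbar_gt.
- now apply open_Rbar_lt.
Qed.

Lemma itv_convex (lo hi : Rbar) (x y z : R) :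
  itv lo hi x -> itv lo hi y -> x <= z <= y -> itv lo hi z.
Proof.
unfold itv; destruct lo, hi; simpl; intuition lra.
Qed.

Definition half (lo hi : Rbar) (e s : R) : R -> Prop :=
  fun rho => itv lo hi rho /\ 0 < e * s * rho.

Lemma half_open (lo hi : Rbar) (e s x : R) :
  half lo hi e s x -> locally x (half lo hi e s).
Proof.
intros [Hi Hs]; apply filter_and; [now apply itv_open|].
apply (open_comp (fun x => e * s * x) (fun y => 0 < y)); [|apply open_gt|exact Hs].
intros y _; apply (ex_derive_continuous (fun x => e * s * x)); auto_derive; easy.
Qed.

Lemma half_convex (lo hi : Rbar) (e s x y z : R) :
  half lo hi e s x -> half lo hi e s y -> x <= z <= y -> half lo hi e s z.
Proof.
intros [Hx Hx'] [Hy Hy'] Hz; split; [now apply (itv_convex lo hi x y)|].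
destruct (Rle_lt_dec 0 (e * s)); nra.
Qed.

Lemma half_cover (lo hi : Rbar) (e r : R) :
  is_sign e -> itv lo hi r -> r <> 0 -> exists s, is_sign s /\ half lo hi e s r.
Proof.
intros He Hr Hr0.
destruct (Rdichotomy _ _ Hr0) as [H|H]; destruct He as [-> | ->].
- exists (-1); split; [now right|split; [easy|lra]].
- exists 1; split; [now left|split; [easy|lra]].
- exists 1; split; [now left|split; [easy|lra]].
- exists (-1); split; [now right|split; [easy|lra]].
Qed.

Lemma const_Hmean_flux (f : R -> R) (k : R) (lo hi : Rbar) :
  C2_on (itv lo hi) f ->
  const_Hmean (itv lo hi) f k <->
  (forall r, itv lo hi r -> grad_norm r (Derive f r) <> 0 ->
     is_derive (fun r => flux r (Derive f r)) r (k / 2)).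
Proof.
intro Hf; split.
- intros H r Hr HN.
  assert (E : r / 1 = r) by field.
  destruct (Hf r Hr) as [H1 [H2 _]].
  assert (Hu : Hmean (urev f) (f r) 1 r = k).
  { apply H; [lra|now rewrite E|unfold urev; rewrite E; ring|].
    rewrite norm_gradH_urev; rewrite ?E; [easy|lra|easy]. }
  rewrite Hmean_urev in Hu; rewrite ?E in *; [|lra| |easy|easy].
  + replace (k / 2) with (Derive (fun r => flux r (Derive f r)) r) by lra.
    apply Derive_correct, ex_derive_over_norm; [auto_derive; easy|easy|easy].
  + generalize (itv_open _ _ _ Hr); apply filter_imp; intros y Hy; now apply Hf.
- intros H a l t Hl Hr Hu HN.
  destruct (Hf _ Hr) as [H1 [H2 _]].
  rewrite norm_gradH_urev in HN by easy.
  rewrite Hmean_urev; try easy.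
  + replace (Derive _ _) with (k / 2)
      by (symmetry; now apply is_derive_unique, H).
    field.
  + generalize (itv_open _ _ _ Hr); apply filter_imp; intros y Hy; now apply Hf.
Qed.

(** Points with r <> 0 are never characteristic, so on each half-line the flux is
    an affine function of slope e h / 2, and the constant c1 is free there.
    Conversely, if the point r = 0 is not characteristic, then the flux is continuous
    there, which forces the affine functions found on the two sides to agree. *)
Lemma const_Hmean_slopes (f : R -> R) (h : R) (lo hi : Rbar) (e : R) :
  is_sign e -> C2_on (itv lo hi) f ->
  const_Hmean (itv lo hi) f (e * h) <->
  (forall s, is_sign s -> exists c1, forall r, half lo hi e s r ->
     Afun h c1 r ^ 2 < 1 + r ^ 2 /\ Derive f r = slope s (Afun h c1 r) r).
Proof.
intros He Hf; rewrite const_Hmean_flux by easy.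
assert (He2 : e * e = 1) by (destruct He as [-> | ->]; ring).
set (G := fun r => flux r (Derive f r) - e * h / 2 * r).
assert (Hlin : forall r, is_derive (fun r => e * h / 2 * r) r (e * h / 2)).
{ intro r; auto_derive; [easy|ring]. }
split.
- intros H s Hs.
  destruct (classic (exists r0, half lo hi e s r0)) as [[r0 Hr0]|Hno].
  2: { exists 0; intros r Hr; destruct Hno; now exists r. }
  exists (- e * G r0); intros r Hr.
  assert (HG : G r = G r0).
  { apply (null_derivative_const (half lo hi e s)); try easy.
    - intros x y z; apply half_convex.
    - intros x [Hx Hx']; replace 0 with (e * h / 2 - e * h / 2) by ring.
      apply @is_derive_minus; [|apply Hlin].
      apply H; [easy|].
      apply Rgt_not_eq, grad_norm_pos; intros ->; lra. }
  apply (flux_slope e); [easy|easy|apply Hr|].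
  unfold Afun.
  replace (- e * (- (h / 2) * r + - e * G r0)) with (e * h / 2 * r + e * e * G r0) by field.
  rewrite He2, <- HG; unfold G; ring.
- intros H r Hr HN.
  assert (Hoff : forall x, itv lo hi x -> x <> 0 -> is_derive G x 0).
  { intros x Hx Hx0.
    destruct (half_cover lo hi e x He Hx Hx0) as [s [Hs Hhx]].
    destruct (H s Hs) as [c1 Hc1].
    apply (is_derive_ext_loc (fun _ => - e * c1)); [|apply @is_derive_const].
    generalize (half_open _ _ _ _ _ Hhx); apply filter_imp; intros y Hy.
    unfold G; rewrite (proj2 (flux_slope e s y _ _ He Hs (proj2 Hy)) (Hc1 y Hy)).
    change (- e * c1 = - e * Afun h c1 y - e * h / 2 * y :> R); unfold Afun; field. }
  assert (HG : is_derive G r 0).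
  { destruct (Req_dec r 0) as [->|Hr0]; [|now apply Hoff].
    apply null_derivative_punctured.
    - apply (ex_derive_continuous G).
      apply @ex_derive_minus; [|eexists; apply Hlin].
      destruct (Hf 0 Hr) as [_ [H2 _]].
      apply ex_derive_over_norm; [auto_derive; easy|easy|easy].
    - generalize (itv_open _ _ _ Hr); apply filter_imp; intros y Hy Hy0.
      now apply Hoff. }
  rewrite <- (Rplus_0_l (e * h / 2)).
  apply (is_derive_ext (fun r => G r + e * h / 2 * r)).
  { intro y; unfold G; change (flux y (Derive f y) - e * h / 2 * y + e * h / 2 * y
      = flux y (Derive f y) :> R); ring. }
  now apply @is_derive_plus.
Qed.

(** * The primitives in the list of profiles *)

Lemma is_derive_arcosh (x : R) : 1 < x -> is_derive arcosh x (/ sqrt (x ^ 2 - 1)).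
Proof.
intro Hx; unfold arcosh.
assert (Hp : 0 < x ^ 2 - 1)
  by (generalize (Rmult_lt_0_compat (x - 1) (x + 1) ltac:(lra) ltac:(lra)); lra).
assert (Hs := sqrt_lt_R0 _ Hp).
auto_derive.
- replace (x * (x * 1) + - (1)) with (x ^ 2 - 1) by ring. repeat split; lra.
- replace (x * (x * 1) + - (1)) with (x ^ 2 - 1) by ring.
  field; split; lra.
Qed.

Lemma is_derive_asin (x : R) : -1 < x < 1 -> is_derive asin x (/ sqrt (1 - x ^ 2)).
Proof.
intro Hx; apply is_derive_Reals.
apply (derive_pt_eq_1 _ _ _ (derivable_pt_asin x Hx)).
rewrite derive_pt_asin; unfold Rdiv; rewrite Rmult_1_l, Rsqr_pow2; easy.
Qed.

Lemma is_derive_acos (x : R) : -1 < x < 1 -> is_derive acos x (- / sqrt (1 - x ^ 2)).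
Proof.
intro Hx; apply is_derive_Reals.
apply (derive_pt_eq_1 _ _ _ (derivable_pt_acos x Hx)).
rewrite derive_pt_acos, Rsqr_pow2; unfold Rdiv; ring.
Qed.

(** An odd extension: the two sign changes, of the factor and of the inner
    derivative, cancel. *)
Lemma is_derive_sign_abs (F : R -> R) (y l : R) :
  y <> 0 -> is_derive F (Rabs y) l ->
  is_derive (fun y => sign y * F (Rabs y)) y l.
Proof.
intros Hy HF.
destruct (Rdichotomy _ _ Hy) as [Hn|Hp].
- apply (is_derive_ext_loc (fun y => - F (- y))).
  + generalize (open_lt 0 y Hn); apply filter_imp; intros z Hz.
    real_eq; rewrite sign_eq_m1, Rabs_left by easy; ring.
  + rewrite Rabs_left in HF by easy.
    auto_derive; [now exists l|].
    replace (Derive _ _) with l by (symmetry; now apply is_derive_unique); ring.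
- apply (is_derive_ext_loc F).
  + generalize (open_gt 0 y Hp); apply filter_imp; intros z Hz.
    real_eq; rewrite sign_eq_1, Rabs_pos_eq by (try easy; now apply Rlt_le); ring.
  + now rewrite Rabs_pos_eq in HF by lra.
Qed.

Lemma is_derive_scaled (F : R -> R) (m y l : R) :
  is_derive F (m * y) l -> is_derive (fun y => F (m * y)) y (m * l).
Proof.
intro HF; auto_derive; [now exists l|].
replace (Derive _ _) with l by (symmetry; now apply is_derive_unique); ring.
Qed.

Lemma primitive_arcsinh (al de y : R) :
  0 < al -> 0 < de ->
  is_derive (fun y => / sqrt al * arcsinh (y / sqrt (de / al))) y
    (/ sqrt (al * y ^ 2 + de)).
Proof.
intros Ha Hd.
assert (Hk : 0 < sqrt (de / al)) by now apply sqrt_lt_R0, Rdiv_lt_0_compat.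
assert (Hk2 : sqrt (de / al) ^ 2 = de / al)
  by (apply pow2_sqrt; apply Rlt_le; now apply Rdiv_lt_0_compat).
set (k := sqrt (de / al)) in *.
apply (is_derive_ext (fun y => / sqrt al * arcsinh (/ k * y))).
{ intro t; real_eq; do 2 f_equal; unfold Rdiv; apply Rmult_comm. }
replace (/ sqrt (al * y ^ 2 + de))
  with (/ sqrt al * (/ k * / sqrt ((/ k * y) ^ 2 + 1))).
{ apply is_derive_scal; apply is_derive_scaled.
  apply is_derive_Reals, derivable_pt_lim_arcsinh. }
rewrite <- (sqrt_pow2 k) at 1 by lra.
assert (0 <= y ^ 2) by apply pow2_ge_0.
rewrite <- !Rinv_mult, <- !sqrt_mult; try nra.
f_equal; f_equal.
replace ((/ k * y) ^ 2) with (/ (k ^ 2) * y ^ 2) by (field; lra).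
rewrite Hk2; field; lra.
Qed.

Lemma primitive_arcosh (al de y : R) :
  0 < al -> 0 < de -> Rabs y > sqrt (de / al) ->
  is_derive (fun y => sign y * (/ sqrt al * arcosh (Rabs y / sqrt (de / al)))) y
    (/ sqrt (al * y ^ 2 - de)).
Proof.
intros Ha Hd Hy.
assert (Hk : 0 < sqrt (de / al)) by now apply sqrt_lt_R0, Rdiv_lt_0_compat.
assert (Hk2 : sqrt (de / al) ^ 2 = de / al)
  by (apply pow2_sqrt; apply Rlt_le; now apply Rdiv_lt_0_compat).
set (k := sqrt (de / al)) in *.
apply (is_derive_sign_abs (fun y => / sqrt al * arcosh (y / k))).
{ intros ->; rewrite Rabs_R0 in Hy; lra. }
apply (is_derive_ext (fun y => / sqrt al * arcosh (/ k * y))).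
{ intro t; real_eq; do 2 f_equal; unfold Rdiv; apply Rmult_comm. }
assert (H1 : 1 < / k * Rabs y).
{ apply Rmult_lt_reg_l with k; [easy|]; rewrite <- Rmult_assoc, Rinv_r; lra. }
replace (/ sqrt (al * y ^ 2 - de))
  with (/ sqrt al * (/ k * / sqrt ((/ k * Rabs y) ^ 2 - 1))).
{ apply is_derive_scal; apply is_derive_scaled; now apply is_derive_arcosh. }
rewrite <- (sqrt_pow2 k) at 1 by lra.
assert (H2 : 0 < (/ k * Rabs y) ^ 2 - 1)
  by (generalize (Rmult_lt_0_compat (/ k * Rabs y - 1) (/ k * Rabs y - 1)
                    ltac:(lra) ltac:(lra)); lra).
rewrite <- !Rinv_mult, <- !sqrt_mult; try nra.
f_equal; f_equal.
replace ((/ k * Rabs y) ^ 2) with (/ (k ^ 2) * y ^ 2)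
  by (rewrite Rpow_mult_distr, pow2_abs; field; lra).
rewrite Hk2; field; lra.
Qed.

Lemma primitive_ln (al y : R) :
  0 < al -> y <> 0 ->
  is_derive (fun y => sign y * (/ sqrt al * ln (Rabs y))) y (/ sqrt (al * y ^ 2)).
Proof.
intros Ha Hy.
apply (is_derive_sign_abs (fun y => / sqrt al * ln y)); [easy|].
rewrite sqrt_mult, Rinv_mult by (try lra; apply pow2_ge_0).
rewrite <- Rsqr_pow2, sqrt_Rsqr_abs.
now apply is_derive_scal, is_derive_ln, Rabs_pos_lt.
Qed.

Lemma primitive_arcsin (al de y : R) :
  al < 0 -> 0 < de -> 0 < al * y ^ 2 + de ->
  is_derive (fun y => / sqrt (- al) * asin (y * sqrt (- al) / sqrt de)) y
    (/ sqrt (al * y ^ 2 + de)).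
Proof.
intros Ha Hd Hy.
assert (Hm : 0 < sqrt (- al)) by (apply sqrt_lt_R0; lra).
assert (Hn : 0 < sqrt de) by now apply sqrt_lt_R0.
assert (Hm2 : sqrt (- al) ^ 2 = - al) by (apply pow2_sqrt; lra).
assert (Hn2 : sqrt de ^ 2 = de) by (apply pow2_sqrt; lra).
set (m := sqrt (- al)) in *; set (n := sqrt de) in *.
apply (is_derive_ext (fun y => / m * asin (m / n * y))).
{ intro t; real_eq; do 2 f_equal; field; lra. }
assert (H2 : 1 - (m / n * y) ^ 2 = (al * y ^ 2 + de) / de).
{ replace ((m / n * y) ^ 2) with (m ^ 2 / n ^ 2 * y ^ 2) by (field; lra).
  rewrite Hm2, Hn2; field; lra. }
assert (H3 : 0 < 1 - (m / n * y) ^ 2) by (rewrite H2; now apply Rdiv_lt_0_compat).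
replace (/ sqrt (al * y ^ 2 + de))
  with (/ m * (m / n * / sqrt (1 - (m / n * y) ^ 2))).
{ apply is_derive_scal; apply is_derive_scaled; apply is_derive_asin.
  generalize H3; generalize (m / n * y); intros z Hz; split; nra. }
rewrite H2, sqrt_div by lra; fold n.
field; repeat split; try lra.
now apply Rgt_not_eq, sqrt_lt_R0.
Qed.

(** The quadratic under the root is that of the flux bound, and completing the
    square in it introduces sigma and Delta. *)
Lemma complement_quadratic (h c1 r : R) :
  1 + r ^ 2 - Afun h c1 r ^ 2 = alpha h * r ^ 2 + beta h c1 * r + gamma c1.
Proof. unfold Afun, alpha, beta, gamma; field. Qed.

Lemma complement_sigma (h c1 r : R) :
  alpha h <> 0 ->
  1 + r ^ 2 - Afun h c1 r ^ 2 = alpha h * Defs.sigma h c1 r ^ 2 + Defs.Delta h c1.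
Proof.
intro H; rewrite complement_quadratic; unfold Defs.Delta, Defs.sigma; field; exact H.
Qed.

Lemma is_derive_sigma (F : R -> R) (h c1 r l : R) :
  is_derive F (Defs.sigma h c1 r) l -> is_derive (fun r => F (Defs.sigma h c1 r)) r l.
Proof.
intro HF; unfold Defs.sigma in *; auto_derive; [now exists l|].
replace (Derive _ _) with l by (symmetry; now apply is_derive_unique); ring.
Qed.

(** * From slopes to profiles *)

Lemma alpha_zero (h : R) : alpha h = 0 -> h = 2 \/ h = -2.
Proof.
unfold alpha; intro H.
assert (E : (h - 2) * (h + 2) = 0) by lra.
destruct (Rmult_integral _ _ E); [left|right]; lra.
Qed.

Lemma is_derive_linear_comb (F : R -> R) (k C r l : R) :
  is_derive F r l -> is_derive (fun r => k * F r + C) r (k * l).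
Proof.
intro HF; auto_derive; [now exists l|].
replace (Derive _ _) with l by (symmetry; now apply is_derive_unique); ring.
Qed.

Lemma g_branch_derive (s h c1 : R) (D : R -> Prop) (g : R -> R) (r : R) :
  locally r D -> Afun h c1 r ^ 2 < 1 + r ^ 2 -> g_branch s h c1 D g ->
  is_derive g r (- s * (h / 4) * / sqrt (1 + r ^ 2 - Afun h c1 r ^ 2)).
Proof.
intros HD HA Hg.
assert (Dr := locally_singleton _ _ HD).
assert (HQ : 0 < 1 + r ^ 2 - Afun h c1 r ^ 2) by lra.
assert (HS := sqrt_lt_R0 _ HQ).
(* D being open, a branch can be differentiated through its formula on D. *)
assert (Hext : forall (F : R -> R) (k C l : R),
  (forall y, D y -> g y = k * F y + C) -> is_derive F r l ->
  is_derive g r (k * l)).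
{ intros F k C l HgF HF.
  apply (is_derive_ext_loc (fun y => k * F y + C)).
  - generalize HD; apply filter_imp; intros y Hy; real_eq; now rewrite HgF.
  - now apply is_derive_linear_comb. }
destruct Hg as [C Hh Hc Hg|C Hh Hc Hg|C Hh Hc Hg|C Ha Hd Hg|C Ha Hd Hg|C Ha Hd Hg|C Ha Hd Hg].
- assert (E : 1 + r ^ 2 - Afun h c1 r ^ 2 = 1 - c1 ^ 2 + 2 * c1 * r)
    by (unfold Afun; rewrite Hh; field).
  rewrite E in *; replace (h / 4) with (/ 2) by (rewrite Hh; field).
  replace (- s * / 2 * / sqrt (1 - c1 ^ 2 + 2 * c1 * r))
    with (- s * (/ (2 * c1) * (2 * c1 / (2 * sqrt (1 - c1 ^ 2 + 2 * c1 * r)))))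
    by (field; split; lra).
  apply (Hext (fun y => / (2 * c1) * sqrt (1 - c1 ^ 2 + 2 * c1 * y)) _ C).
  { intros y Hy; rewrite Hg by easy; field; easy. }
  apply is_derive_scal, (is_derive_sqrt (fun y => 1 - c1 ^ 2 + 2 * c1 * y)); [auto_derive; [easy|ring]|easy].
- assert (E : 1 + r ^ 2 - Afun h c1 r ^ 2 = 1 - c1 ^ 2 - 2 * c1 * r)
    by (unfold Afun; rewrite Hh; field).
  rewrite E in *; replace (h / 4) with (- / 2) by (rewrite Hh; field).
  replace (- s * - / 2 * / sqrt (1 - c1 ^ 2 - 2 * c1 * r))
    with (- s * (/ (2 * c1) * (- (2 * c1) / (2 * sqrt (1 - c1 ^ 2 - 2 * c1 * r)))))
    by (field; split; lra).
  apply (Hext (fun y => / (2 * c1) * sqrt (1 - c1 ^ 2 - 2 * c1 * y)) _ C).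
  { intros y Hy; rewrite Hg by easy; field; easy. }
  apply is_derive_scal, (is_derive_sqrt (fun y => 1 - c1 ^ 2 - 2 * c1 * y)); [auto_derive; [easy|ring]|easy].
- assert (E : 1 + r ^ 2 - Afun h c1 r ^ 2 = 1)
    by (unfold Afun; rewrite Hc; destruct Hh as [-> | ->]; field).
  rewrite E, sqrt_1, Rinv_1.
  apply (Hext (fun y => y) _ C); [exact Hg|apply @is_derive_id].
- rewrite complement_sigma by lra.
  apply (Hext (fun y => / sqrt (alpha h) *
    arcsinh (Defs.sigma h c1 y / sqrt (Defs.Delta h c1 / alpha h))) _ C).
  { intros y Hy; rewrite Hg by easy; ring. }
  apply (is_derive_sigma (fun z => / sqrt (alpha h) *
    arcsinh (z / sqrt (Defs.Delta h c1 / alpha h)))).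
  now apply primitive_arcsinh.
- rewrite complement_sigma by lra.
  replace (Defs.Delta h c1) with (- Rabs (Defs.Delta h c1)) by (rewrite Rabs_left; lra).
  apply (Hext (fun y => sign (Defs.sigma h c1 y) * (/ sqrt (alpha h) *
    arcosh (Rabs (Defs.sigma h c1 y) / sqrt (Rabs (Defs.Delta h c1) / alpha h)))) _ C).
  { intros y Hy; rewrite (proj2 (Hg y Hy)); ring. }
  apply (is_derive_sigma (fun z => sign z * (/ sqrt (alpha h) *
    arcosh (Rabs z / sqrt (Rabs (Defs.Delta h c1) / alpha h))))).
  apply primitive_arcosh; [easy|apply Rabs_pos_lt; lra|now apply Hg].
- rewrite complement_sigma, Hd, Rplus_0_r by lra.
  apply (Hext (fun y => sign (Defs.sigma h c1 y) *
    (/ sqrt (alpha h) * ln (Rabs (Defs.sigma h c1 y)))) _ C).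
  { intros y Hy; rewrite (proj2 (Hg y Hy)); ring. }
  apply (is_derive_sigma (fun z => sign z * (/ sqrt (alpha h) * ln (Rabs z)))).
  apply primitive_ln; [easy|now apply Hg].
- rewrite complement_sigma in * by lra.
  apply (Hext (fun y => / sqrt (- alpha h) *
    asin (Defs.sigma h c1 y * sqrt (- alpha h) / sqrt (Defs.Delta h c1))) _ C).
  { intros y Hy; rewrite (proj2 (Hg y Hy)); ring. }
  apply (is_derive_sigma (fun z => / sqrt (- alpha h) *
    asin (z * sqrt (- alpha h) / sqrt (Defs.Delta h c1)))).
  now apply primitive_arcsin.
Qed.

Lemma g_branch_shift (s h c1 : R) (D : R -> Prop) (g : R -> R) (C0 : R) :
  g_branch s h c1 D g -> g_branch s h c1 D (fun r => g r + C0).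
Proof.
intro Hg.
destruct Hg as [C Hh Hc Hg|C Hh Hc Hg|C Hh Hc Hg|C Ha Hd Hg|C Ha Hd Hg|C Ha Hd Hg|C Ha Hd Hg].
- apply g_plus2 with (C + C0); try easy; intros r Hr; rewrite Hg by easy; ring.
- apply g_minus2 with (C + C0); try easy; intros r Hr; rewrite Hg by easy; ring.
- apply g_lin with (C + C0); try easy; intros r Hr; rewrite Hg by easy; ring.
- apply g_arcsinh with (C + C0); try easy; intros r Hr; rewrite Hg by easy; ring.
- apply g_arcosh with (C + C0); try easy; intros r Hr; destruct (Hg r Hr) as [? ->];
    split; [easy|ring].
- apply g_ln with (C + C0); try easy; intros r Hr; destruct (Hg r Hr) as [? ->];
    split; [easy|ring].
- apply g_arcsin with (C + C0); try easy; intros r Hr; destruct (Hg r Hr) as [? ->];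
    split; [easy|ring].
Qed.


(** On a nonempty domain the positivity of alpha sigma^2 + Delta excludes
    alpha < 0 with Delta <= 0, and yields the inequalities on sigma that the
    branches demand. *)
Lemma g_branch_exists (s h c1 : R) (D : R -> Prop) :
  (exists r, D r) -> (forall r, D r -> Afun h c1 r ^ 2 < 1 + r ^ 2) ->
  exists g, g_branch s h c1 D g.
Proof.
intros [r0 Hr0] HD.
destruct (Rtotal_order (alpha h) 0) as [Ha|[Ha|Ha]].
- assert (HS : forall r, D r -> 0 < alpha h * Defs.sigma h c1 r ^ 2 + Defs.Delta h c1).
  { intros r Hr; rewrite <- complement_sigma by lra; specialize (HD r Hr); lra. }
  assert (Hd : 0 < Defs.Delta h c1).
  { specialize (HS r0 Hr0); generalize (pow2_ge_0 (Defs.sigma h c1 r0)); nra. }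
  eexists; apply g_arcsin with 0; [easy|easy|].
  intros r Hr; split; [|reflexivity].
  rewrite <- sqrt_Rsqr_abs, Rsqr_pow2; apply sqrt_lt_1_alt.
  split; [apply pow2_ge_0|].
  specialize (HS r Hr).
  replace (- Defs.Delta h c1 / alpha h) with (Defs.Delta h c1 / - alpha h) by (field; lra).
  apply -> Rlt_div_r; [|lra]; lra.
- assert (Hh := alpha_zero h Ha).
  destruct (Req_dec c1 0) as [Hc|Hc].
  + eexists; apply g_lin with 0; [exact Hh|easy|]; intros r Hr; reflexivity.
  + destruct Hh as [Hh|Hh].
    * eexists; apply g_plus2 with 0; [easy|easy|]; intros r Hr; reflexivity.
    * eexists; apply g_minus2 with 0; [easy|easy|]; intros r Hr; reflexivity.
- assert (HS : forall r, D r -> 0 < alpha h * Defs.sigma h c1 r ^ 2 + Defs.Delta h c1).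
  { intros r Hr; rewrite <- complement_sigma by lra; specialize (HD r Hr); lra. }
  destruct (Rtotal_order (Defs.Delta h c1) 0) as [Hd|[Hd|Hd]].
  + eexists; apply g_arcosh with 0; [easy|easy|].
    intros r Hr; split; [|reflexivity].
    rewrite (Rabs_left (Defs.Delta h c1)) by easy.
    rewrite <- sqrt_Rsqr_abs, Rsqr_pow2; apply sqrt_lt_1_alt.
    specialize (HS r Hr); split.
    * apply Rlt_le, Rdiv_lt_0_compat; lra.
    * apply <- Rlt_div_l; [|lra]; lra.
  + eexists; apply g_ln with 0; [easy|easy|].
    intros r Hr; split; [|reflexivity].
    intro H0; specialize (HS r Hr); rewrite H0, Hd in HS; lra.
  + eexists; apply g_arcsinh with 0; [easy|easy|]; intros r Hr; reflexivity.
Qed.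

(** Even over an empty domain a branch fixes the signs of alpha and Delta; the
    constant c1 = 0, for which Delta = 1, makes one of them available for every h. *)
Lemma g_branch_empty (s h : R) (D : R -> Prop) :
  (forall r, ~ D r) -> exists g, g_branch s h 0 D g.
Proof.
intro HD.
assert (Hd : alpha h <> 0 -> Defs.Delta h 0 = 1)
  by (intro H; unfold Defs.Delta, gamma, beta; field; easy).
exists (fun _ => 0).
destruct (Rtotal_order (alpha h) 0) as [Ha|[Ha|Ha]].
- apply g_arcsin with 0; [easy|rewrite Hd; lra|]; intros r Hr; now destruct (HD r).
- apply g_lin with 0; [now apply alpha_zero|easy|]; intros r Hr; now destruct (HD r).
- apply g_arcsinh with 0; [easy|rewrite Hd; lra|]; intros r Hr; now destruct (HD r).
Qed.

Lemma sqrt_gt_Rabs (x y : R) : 0 < x -> sqrt x > Rabs y <-> y ^ 2 < x.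
Proof.
intro Hx; rewrite <- sqrt_Rsqr_abs, Rsqr_pow2; split.
- intro H; apply sqrt_lt_0_alt; exact H.
- intro H; apply sqrt_lt_1_alt; split; [apply pow2_ge_0|exact H].
Qed.

Definition angle (s h c1 r : R) : R :=
  atan r / 2 + s * (/ 2 * acos (Afun h c1 r / sqrt (r ^ 2 + 1))).

(** The derivative of the arccos term splits into the part A r / (q sqrt (q - A^2))
    of the slope and a remainder in h alone, which the branches g compensate. *)
Lemma is_derive_angle (s h c1 r : R) :
  Afun h c1 r ^ 2 < 1 + r ^ 2 ->
  is_derive (angle s h c1) r
    (slope s (Afun h c1 r) r + s * (h / 4) * / sqrt (1 + r ^ 2 - Afun h c1 r ^ 2)).
Proof.
intro HA; unfold angle.
set (A := Afun h c1 r) in *.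
assert (Hq : 0 < r ^ 2 + 1) by (generalize (pow2_ge_0 r); lra).
assert (Hk : 0 < sqrt (r ^ 2 + 1)) by now apply sqrt_lt_R0.
assert (Hk2 : sqrt (r ^ 2 + 1) ^ 2 = r ^ 2 + 1) by (apply pow2_sqrt; lra).
assert (HR : 0 < sqrt (1 + r ^ 2 - A ^ 2)) by (apply sqrt_lt_R0; lra).
set (k := sqrt (r ^ 2 + 1)) in *.
set (R0 := sqrt (1 + r ^ 2 - A ^ 2)) in *.
assert (Hx : 1 - (A / k) ^ 2 = (1 + r ^ 2 - A ^ 2) / k ^ 2).
{ rewrite <- (Rplus_comm (r ^ 2)), <- Hk2; field; lra. }
assert (Hxpos : 0 < 1 - (A / k) ^ 2).
{ rewrite Hx; apply Rdiv_lt_0_compat; nra. }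
assert (Hratio : is_derive (fun r => Afun h c1 r / sqrt (r ^ 2 + 1)) r
  (- (h / 2) / k - A * r / k ^ 3)).
{ unfold Afun; auto_derive.
  - split; [|split]; try easy; try lra.
    replace (r * (r * 1) + 1) with (r ^ 2 + 1) by ring; fold k; lra.
  - replace (r * (r * 1) + 1) with (r ^ 2 + 1) by ring; fold k.
    fold (Afun h c1 r); unfold A, Afun; field; lra. }
assert (Hacos : is_derive (fun r => acos (Afun h c1 r / sqrt (r ^ 2 + 1))) r
  ((- (h / 2) / k - A * r / k ^ 3) * - (k / R0))).
{ apply (is_derive_comp acos (fun r => Afun h c1 r / sqrt (r ^ 2 + 1))); [|exact Hratio].
  fold A; fold k.
  replace (k / R0) with (/ sqrt (1 - (A / k) ^ 2)).
  - apply is_derive_acos.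
    generalize Hxpos; generalize (A / k); intros z Hz; split; nra.
  - rewrite Hx, sqrt_div, sqrt_pow2 by nra; fold R0; field; lra. }
replace (slope s A r + s * (h / 4) * / R0)
  with (/ (1 + r ^ 2) / 2 + s * (/ 2 * ((- (h / 2) / k - A * r / k ^ 3) * - (k / R0)))).
- apply @is_derive_plus.
  + unfold Rdiv; auto_derive; [easy|]. unfold Rsqr; field. nra.
  + now apply is_derive_scal, is_derive_scal.
- unfold slope; fold R0.
  replace (1 + r ^ 2) with (k ^ 2) by lra.
  field; lra.
Qed.

(** The profiles are exactly the functions with the prescribed slopes, since two
    functions with equal derivatives on an interval differ by a constant, and the
    branches are stable under adding one.  When D is empty the constant c1 given on
    the right may admit no branch, and is replaced by 0. *)
Lemma cmc_profile_slopes (s h : R) (D : R -> Prop) (f : R -> R) :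
  (forall x, D x -> locally x D) ->
  (forall x y z, D x -> D y -> x <= z <= y -> D z) ->
  (forall x, D x -> ex_derive f x) ->
  cmc_profile s h D f <->
  exists c1, forall r, D r ->
    Afun h c1 r ^ 2 < 1 + r ^ 2 /\ Derive f r = slope s (Afun h c1 r) r.
Proof.
intros Hopen Hconv Hf.
assert (Hdom : forall c1 r,
  sqrt (r ^ 2 + 1) > Rabs (c1 - h / 2 * r) <-> Afun h c1 r ^ 2 < 1 + r ^ 2).
{ intros c1 r; rewrite sqrt_gt_Rabs by (generalize (pow2_ge_0 r); lra).
  unfold Afun; replace (- (h / 2) * r + c1) with (c1 - h / 2 * r) by ring.
  now rewrite (Rplus_comm 1). }
split.
- intros (c1 & g & Hg & Hfg); exists c1; intros r Hr.
  destruct (Hfg r Hr) as [HA _]; rewrite Hdom in HA; split; [easy|].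
  apply is_derive_unique, (is_derive_ext_loc (fun r => angle s h c1 r + g r)).
  { generalize (Hopen r Hr); apply filter_imp; intros y Hy; real_eq.
    now rewrite (proj2 (Hfg y Hy)). }
  replace (slope s (Afun h c1 r) r) with
    (slope s (Afun h c1 r) r + s * (h / 4) * / sqrt (1 + r ^ 2 - Afun h c1 r ^ 2)
     + - s * (h / 4) * / sqrt (1 + r ^ 2 - Afun h c1 r ^ 2)) by ring.
  apply @is_derive_plus; [now apply is_derive_angle|].
  apply g_branch_derive with (D := D); [now apply Hopen|easy|easy].
- intros (c1 & Hslope).
  destruct (classic (exists r0, D r0)) as [[r0 Hr0]|Hno].
  2: { destruct (g_branch_empty s h D) as [g Hg]; [intros r Hr; destruct Hno; now exists r|].
       exists 0, g; split; [easy|]; intros r Hr; destruct Hno; now exists r. }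
  destruct (g_branch_exists s h c1 D) as [g Hg]; [now exists r0|apply Hslope|].
  exists c1, (fun r => g r + (f r0 - (angle s h c1 r0 + g r0))).
  split; [now apply g_branch_shift|]; intros r Hr.
  split; [now apply Hdom, Hslope|].
  assert (E : f r - (angle s h c1 r + g r) = f r0 - (angle s h c1 r0 + g r0)).
  { apply (null_derivative_const D (fun r => f r - (angle s h c1 r + g r))); try easy.
    intros x Hx; destruct (Hslope x Hx) as [HA Hp].
    replace 0 with (Derive f x -
      (slope s (Afun h c1 x) x + s * (h / 4) * / sqrt (1 + x ^ 2 - Afun h c1 x ^ 2)
       + - s * (h / 4) * / sqrt (1 + x ^ 2 - Afun h c1 x ^ 2))) by (rewrite Hp; ring).
    apply @is_derive_minus; [now apply Derive_correct, Hf|].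
    apply @is_derive_plus; [now apply is_derive_angle|].
    apply g_branch_derive with (D := D); [now apply Hopen|easy|easy]. }
  rewrite <- E; unfold angle; ring.
Qed.

(** * Entire minimal profiles *)

Lemma same_derivative (f F d : R -> R) :
  (forall r, is_derive f r (d r)) -> (forall r, is_derive F r (d r)) ->
  exists C, forall r, f r = F r + C.
Proof.
intros Hf HF; exists (f 0 - F 0); intro r.
enough (f r - F r = f 0 - F 0) by lra.
apply (null_derivative_const (fun _ => True) (fun r => f r - F r)); try easy.
intros x _; replace 0 with (d x - d x) by ring.
now apply @is_derive_minus.
Qed.

Lemma is_derive_atan_term (k r : R) :
  is_derive (fun r => / 2 * (k * atan r + atan r)) r ((1 + k) / (2 * (1 + r ^ 2))).
Proof.
assert (H := pow2_ge_0 r).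
auto_derive; [easy|]; unfold Rsqr; field; lra.
Qed.

Lemma is_derive_atan_sqrt_term (s c r : R) :
  0 < c < 1 ->
  is_derive (fun r => / 2 * (s * atan (sqrt ((r ^ 2 + c) / (1 - c))) + atan r)) r
    (slope s (sqrt (1 - c)) r).
Proof.
intro Hc; assert (H := pow2_ge_0 r).
unfold slope; rewrite (pow2_sqrt (1 - c)) by lra.
replace (1 + r ^ 2 - (1 - c)) with (r ^ 2 + c) by ring.
assert (Hm : 0 < sqrt (1 - c)) by (apply sqrt_lt_R0; lra).
assert (Hn : 0 < sqrt (r ^ 2 + c)) by (apply sqrt_lt_R0; lra).
assert (Hm2 : sqrt (1 - c) ^ 2 = 1 - c) by (apply pow2_sqrt; lra).
assert (Hn2 : sqrt (r ^ 2 + c) ^ 2 = r ^ 2 + c) by (apply pow2_sqrt; lra).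
assert (Hpos : 0 < (r ^ 2 + c) / (1 - c)) by (apply Rdiv_lt_0_compat; lra).
assert (Hq : sqrt ((r ^ 2 + c) / (1 - c)) = sqrt (r ^ 2 + c) / sqrt (1 - c))
  by (apply sqrt_div; lra).
auto_derive.
- replace ((r * (r * 1) + c) * / (1 - c)) with ((r ^ 2 + c) / (1 - c)) by (field; lra).
  easy.
- replace ((r * (r * 1) + c) * / (1 - c)) with ((r ^ 2 + c) / (1 - c)) by (field; lra).
  rewrite Hq; unfold Rsqr.
  set (m := sqrt (1 - c)) in *; set (n := sqrt (r ^ 2 + c)) in *.
  replace (1 - c) with (m ^ 2) by lra.
  replace (1 + n / m * (n / m * 1)) with ((1 + r ^ 2) / m ^ 2)
    by (replace (1 + r ^ 2) with (m ^ 2 + n ^ 2) by lra; field; lra).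
  field; lra.
Qed.

(** Here w stands for 2 (1 + r^2) f' - 1.  Its formula on one side of 0, with h = 0,
    leaves only |c| <= 1, because c^2 < 1 + r^2 holds for all small r.  If |c| = 1,
    then w is the constant c on that side; otherwise w vanishes at 0, which is
    then characteristic, and w'(0) recovers c up to the sign s. *)
Lemma deviation_at_origin (w : R -> R) (s c : R) :
  is_sign s -> ex_derive w 0 ->
  (forall r, 0 < s * r ->
     c ^ 2 < 1 + r ^ 2 /\ w r = s * (c * r / sqrt (1 + r ^ 2 - c ^ 2))) ->
  (c ^ 2 = 1 /\ w 0 = c)
  \/ (c ^ 2 < 1 /\ w 0 = 0 /\ Derive w 0 = s * (c / sqrt (1 - c ^ 2))).
Proof.
intros Hs Hw H.
assert (Hs2 : s * s = 1) by (destruct Hs as [-> | ->]; ring).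
(* Reflecting by s turns the half-line s r > 0 into r > 0. *)
set (v := fun r => w (s * r)).
assert (Hv : is_derive v 0 (s * Derive w 0)).
{ apply is_derive_scaled; rewrite Rmult_0_r; now apply Derive_correct. }
assert (Hv0 : v 0 = w 0) by (unfold v; now rewrite Rmult_0_r).
assert (Hvr : forall r, 0 < r -> c ^ 2 < 1 + r ^ 2 /\ v r = c * r / sqrt (1 + r ^ 2 - c ^ 2)).
{ intros r Hr; destruct (H (s * r)) as [H1 H2].
  { rewrite <- Rmult_assoc, Hs2; lra. }
  replace ((s * r) ^ 2) with (r ^ 2) in * by (rewrite Rpow_mult_distr; simpl; nra).
  split; [easy|]; unfold v; rewrite H2; unfold Rdiv.
  replace (s * (c * (s * r) * / sqrt (1 + r ^ 2 - c ^ 2)))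
    with ((s * s) * (c * r * / sqrt (1 + r ^ 2 - c ^ 2))) by ring.
  rewrite Hs2; ring. }
destruct (Rtotal_order (c ^ 2) 1) as [Hc|[Hc|Hc]].
- right; split; [easy|].
  set (phi := fun r => c * r / sqrt (1 + r ^ 2 - c ^ 2)).
  assert (Hpos : 0 < sqrt (1 - c ^ 2)) by (apply sqrt_lt_R0; lra).
  assert (Hphi : is_derive phi 0 (c / sqrt (1 - c ^ 2))).
  { unfold phi; auto_derive;
      replace (1 + 0 * (0 * 1) + - (c * (c * 1))) with (1 - c ^ 2) by ring.
    - repeat split; lra.
    - field; lra. }
  assert (Hd : is_derive (fun r => v r - phi r) 0 (s * Derive w 0 - c / sqrt (1 - c ^ 2)))
    by now apply @is_derive_minus.
  assert (Hz : forall r, 0 < r -> v r - phi r = 0).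
  { intros r Hr; rewrite (proj2 (Hvr r Hr)); unfold phi; ring. }
  split.
  + rewrite <- Hv0; replace (v 0) with (v 0 - phi 0) by (unfold phi, Rdiv; ring).
    apply (right_germ_value (fun r => v r - phi r)); [|exact Hz].
    apply (ex_derive_continuous (fun r => v r - phi r)); eexists; exact Hd.
  + assert (E := right_germ_derive _ _ Hd Hz).
    replace (Derive w 0) with (s * (s * Derive w 0)) by (rewrite <- Rmult_assoc, Hs2; ring).
    f_equal; lra.
- left; split; [easy|].
  rewrite <- Hv0; enough (v 0 - c = 0) by lra.
  apply (right_germ_value (fun r => v r - c)).
  + apply (ex_derive_continuous (fun r => v r - c)); eexists.
    apply @is_derive_minus; [exact Hv|apply @is_derive_const].
  + intros r Hr; rewrite (proj2 (Hvr r Hr)), Hc.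
    replace (1 + r ^ 2 - 1) with (r ^ 2) by ring.
    rewrite sqrt_pow2 by lra; field; lra.
- exfalso.
  assert (Hr : 0 < sqrt (c ^ 2 - 1)) by (apply sqrt_lt_R0; lra).
  destruct (Hvr _ Hr) as [Hlt _]; rewrite pow2_sqrt in Hlt; lra.
Qed.

(** Writing t for the common value, both a and b equal t / sqrt (1 + t^2). *)
Lemma div_sqrt_complement_inj (a b : R) :
  a ^ 2 < 1 -> b ^ 2 < 1 -> a / sqrt (1 - a ^ 2) = b / sqrt (1 - b ^ 2) -> a = b.
Proof.
intros Ha Hb E.
assert (Hk : forall x, x ^ 2 < 1 -> 0 < sqrt (1 - x ^ 2) /\ sqrt (1 - x ^ 2) ^ 2 = 1 - x ^ 2).
{ intros x Hx; split; [apply sqrt_lt_R0; lra|apply pow2_sqrt; lra]. }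
destruct (Hk a Ha) as [Hm Hm2]; destruct (Hk b Hb) as [Hn Hn2].
set (m := sqrt (1 - a ^ 2)) in *; set (n := sqrt (1 - b ^ 2)) in *.
set (t := a / m) in *.
assert (Ea : a = t * m) by (unfold t; field; lra).
assert (Eb : b = t * n) by (rewrite E; field; lra).
clearbody t m n; subst a b.
assert (m ^ 2 * (1 + t ^ 2) = n ^ 2 * (1 + t ^ 2)) by lra.
assert (m ^ 2 = n ^ 2) by (apply Rmult_eq_reg_r with (1 + t ^ 2); generalize (pow2_ge_0 t); lra).
f_equal; apply Rsqr_inj; try lra; rewrite !Rsqr_pow2; easy.
Qed.

(** Since w is differentiable at 0, the data a on the right and b on the left must
    match.  Comparing w(0) excludes that exactly one of |a|, |b| is 1, and gives
    a = b if both are; comparing w'(0) gives b = - a if both are smaller than 1.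
    In either case one formula for f' holds on the whole line; a = 0, 0 < |a| < 1 and
    |a| = 1 give the three kinds of minimal profiles, with c = 1 - a^2. *)
Lemma minimal_profile_of_slopes (f : R -> R) :
  (forall s, is_sign s -> exists c1, forall r, 0 < s * r ->
     c1 ^ 2 < 1 + r ^ 2 /\ Derive f r = slope s c1 r) ->
  C2_on (fun _ => True) f -> minimal_profile f.
Proof.
intros H Hf.
destruct (H 1 (or_introl eq_refl)) as [a Ha].
destruct (H (-1) (or_intror eq_refl)) as [b Hb].
set (w := fun r => 2 * (1 + r ^ 2) * Derive f r - 1).
assert (Hq : forall r, 0 < 1 + r ^ 2) by (intro r; generalize (pow2_ge_0 r); lra).
assert (Hfw : forall r, is_derive f r ((1 + w r) / (2 * (1 + r ^ 2)))).
{ intro r; replace ((1 + w r) / (2 * (1 + r ^ 2))) with (Derive f r)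
    by (unfold w; field; apply Rgt_not_eq, Hq).
  apply Derive_correct; now destruct (Hf r I). }
assert (Hw0 : ex_derive w 0).
{ destruct (Hf 0 I) as [_ [H2 _]]; unfold w; auto_derive; easy. }
assert (Hws : forall s c, (forall r, 0 < s * r ->
    c ^ 2 < 1 + r ^ 2 /\ Derive f r = slope s c r) ->
  forall r, 0 < s * r ->
    c ^ 2 < 1 + r ^ 2 /\ w r = s * (c * r / sqrt (1 + r ^ 2 - c ^ 2))).
{ intros s c Hc r Hr; destruct (Hc r Hr) as [H1 H2]; split; [easy|].
  unfold w; rewrite H2; unfold slope; field; split.
  - apply Rgt_not_eq, sqrt_lt_R0; lra.
  - apply Rgt_not_eq, Hq. }
assert (Ha' := Hws _ _ Ha); assert (Hb' := Hws _ _ Hb).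
destruct (deviation_at_origin w 1 a) as [[Ha2 Ha0]|[Ha2 [Ha0 Ha1]]];
  [now left|easy|easy| |];
destruct (deviation_at_origin w (-1) b) as [[Hb2 Hb0]|[Hb2 [Hb0 Hb1]]];
  try (now right); try easy; try nra.
- assert (Eab : a = b) by lra; rewrite <- Eab in Hb2, Hb'.
  right; right.
  destruct (same_derivative f (fun r => / 2 * (a * atan r + atan r))
    (fun r => (1 + a) / (2 * (1 + r ^ 2)))) as [C HC].
  + intro r; replace a with (w r); [apply Hfw|].
    destruct (Rtotal_order r 0) as [Hr|[->|Hr]].
    * rewrite (proj2 (Hb' r ltac:(lra))), Hb2.
      replace (1 + r ^ 2 - 1) with ((- r) ^ 2) by ring.
      rewrite sqrt_pow2 by lra; field; lra.
    * easy.
    * rewrite (proj2 (Ha' r ltac:(lra))), Hb2.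
      replace (1 + r ^ 2 - 1) with (r ^ 2) by ring.
      rewrite sqrt_pow2 by lra; field; lra.
  + intro r; apply is_derive_atan_term.
  + exists a, C; split; [|exact HC].
    assert (E : (a - 1) * (a + 1) = 0) by lra.
    destruct (Rmult_integral _ _ E); [left|right]; lra.
- assert (Eab : b = - a).
  { assert (E : - b = a); [|lra].
    apply div_sqrt_complement_inj; [nra|easy|].
    replace ((- b) ^ 2) with (b ^ 2) by ring.
    unfold Rdiv in *; lra. }
  subst b.
  assert (Hslope : forall r, is_derive f r (slope 1 a r)).
  { intro r; replace (slope 1 a r) with ((1 + w r) / (2 * (1 + r ^ 2))); [apply Hfw|].
    unfold slope; do 2 f_equal.
    destruct (Rtotal_order r 0) as [Hr|[->|Hr]].
    - rewrite (proj2 (Hb' r ltac:(lra))).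
      replace ((- a) ^ 2) with (a ^ 2) by ring; unfold Rdiv; ring.
    - rewrite Ha0; unfold Rdiv; ring.
    - now rewrite (proj2 (Ha' r ltac:(lra))). }
  destruct (Req_dec a 0) as [->|Ha3].
  + right; left.
    destruct (same_derivative f (fun r => / 2 * (0 * atan r + atan r)) _ Hslope)
      as [C HC].
    { intro r; replace (slope 1 0 r) with ((1 + 0) / (2 * (1 + r ^ 2)));
        [apply is_derive_atan_term|unfold slope, Rdiv; ring]. }
    exists C; intro r; rewrite HC; ring.
  + left.
    assert (Hac : 0 < a ^ 2) by now apply pow2_gt_0.
    assert (Hs : is_sign (sign a) /\ sign a * sqrt (a ^ 2) = a).
    { rewrite <- Rsqr_pow2, sqrt_Rsqr_abs.
      destruct (Rdichotomy _ _ Ha3) as [Hn|Hp].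
      - rewrite sign_eq_m1, Rabs_left by easy; split; [now right|ring].
      - rewrite sign_eq_1, Rabs_pos_eq by lra; split; [now left|ring]. }
    destruct (same_derivative f (fun r => / 2 *
      (sign a * atan (sqrt ((r ^ 2 + (1 - a ^ 2)) / (1 - (1 - a ^ 2)))) + atan r)) _ Hslope)
      as [C HC].
    { intro r; replace (slope 1 a r) with (slope (sign a) (sqrt (1 - (1 - a ^ 2))) r);
        [apply is_derive_atan_sqrt_term; lra|].
      replace (1 - (1 - a ^ 2)) with (a ^ 2) by ring.
      unfold slope; rewrite pow2_sqrt by lra.
      unfold Rdiv; rewrite <- !Rmult_assoc, (proj2 Hs); ring. }
    exists (sign a), (1 - a ^ 2), C; split; [apply Hs|]; split; [lra|exact HC].
Qed.

Lemma slopes_of_minimal_profile (f : R -> R) :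
  minimal_profile f ->
  forall s, is_sign s -> exists c1, forall r, 0 < s * r ->
     c1 ^ 2 < 1 + r ^ 2 /\ Derive f r = slope s c1 r.
Proof.
intros Hf s Hs.
assert (Hs2 : s * s = 1) by (destruct Hs as [-> | ->]; ring).
assert (Hr2 : forall r, 0 < s * r -> 0 < r ^ 2)
  by (intros r Hr; apply pow2_gt_0; intros ->; lra).
assert (HD : forall (F : R -> R) (C r l : R), (forall r, f r = F r + C) ->
  is_derive F r l -> Derive f r = l).
{ intros F C r l HF Hl; apply is_derive_unique, (is_derive_ext (fun r => F r + C)).
  - intro t; now rewrite HF.
  - auto_derive; [now exists l|].
    replace (Derive _ _) with l by (symmetry; now apply is_derive_unique); ring. }
destruct Hf as [(s' & c & C & Hs' & Hc & HF)|[(C & HF)|(s' & C & Hs' & HF)]].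
- exists (s * s' * sqrt (1 - c)); intros r Hr; specialize (Hr2 r Hr).
  assert (Hs2' : s' * s' = 1) by (destruct Hs' as [-> | ->]; ring).
  assert (E : (s * s' * sqrt (1 - c)) ^ 2 = sqrt (1 - c) ^ 2).
  { replace ((s * s' * sqrt (1 - c)) ^ 2)
      with ((s * s) * (s' * s') * sqrt (1 - c) ^ 2) by ring.
    rewrite Hs2, Hs2'; ring. }
  split; [rewrite E, pow2_sqrt; lra|].
  rewrite (HD _ _ r _ HF (is_derive_atan_sqrt_term s' c r Hc)).
  unfold slope; rewrite E; do 2 f_equal; unfold Rdiv.
  rewrite <- !Rmult_assoc, Hs2; ring.
- exists 0; intros r Hr; specialize (Hr2 r Hr); split; [lra|].
  rewrite (HD (fun r => / 2 * (0 * atan r + atan r)) C r ((1 + 0) / (2 * (1 + r ^ 2)))).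
  + unfold slope, Rdiv; ring.
  + intro t; rewrite HF; ring.
  + apply is_derive_atan_term.
- exists s'; intros r Hr; specialize (Hr2 r Hr).
  assert (E : s' ^ 2 = 1) by (destruct Hs' as [-> | ->]; ring).
  split; [lra|].
  rewrite (HD _ _ r _ HF (is_derive_atan_term s' r)).
  unfold slope; rewrite E.
  replace (1 + r ^ 2 - 1) with ((s * r) ^ 2)
    by (replace ((s * r) ^ 2) with ((s * s) * r ^ 2) by ring; rewrite Hs2; ring).
  rewrite sqrt_pow2 by lra.
  do 2 f_equal; field; split; intros ->; lra.
Qed.

(* In the second part, e = 1 describes the surfaces of curvature h: the sign s
   in front of arccos is that of rho, and the constants may differ on the two
   sides of rho = 0.  The case e = -1 is the other choice of signs: the same
   formulas then give curvature - h for the defining function a - f(rho),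
   that is, curvature h for f(rho) - a. *)
Theorem theorem4p21 (f : R -> R) (h : R) :
  (h = 0 ->
   C2_on (itv m_infty p_infty) f ->
   (const_Hmean (itv m_infty p_infty) f h <-> minimal_profile f))
  /\
  (forall (lo hi : Rbar) (e : R),
   is_sign e ->
   C2_on (itv lo hi) f ->
   (const_Hmean (itv lo hi) f (e * h) <->
    forall s : R, is_sign s ->
      cmc_profile s h (fun rho => itv lo hi rho /\ 0 < e * s * rho) f)).
Proof.
split.
- intros -> Hf.
  assert (HA : forall c r, Afun 0 c r = c) by (intros; unfold Afun; field).
  rewrite <- (Rmult_0_r 1) at 1.
  rewrite const_Hmean_slopes; [|now left|easy].
  transitivity (forall s, is_sign s -> exists c1, forall r, 0 < s * r ->
    c1 ^ 2 < 1 + r ^ 2 /\ Derive f r = slope s c1 r).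
  + split; intros H s Hs; destruct (H s Hs) as [c Hc]; exists c; intros r Hr.
    * destruct (Hc r) as [H1 H2]; [split; [easy|lra]|].
      now rewrite HA in H1, H2.
    * rewrite HA; apply Hc; destruct Hr as [_ Hr]; lra.
  + split; intro H; [|now apply slopes_of_minimal_profile].
    apply minimal_profile_of_slopes; [easy|]; intros x _; now apply Hf.
- intros lo hi e He Hf.
  rewrite const_Hmean_slopes by easy.
  assert (Hp : forall s, cmc_profile s h (half lo hi e s) f <->
    exists c1, forall r, half lo hi e s r ->
      Afun h c1 r ^ 2 < 1 + r ^ 2 /\ Derive f r = slope s (Afun h c1 r) r).
  { intro s; apply cmc_profile_slopes.
    - apply half_open.
    - intros x y z; apply half_convex.
    - intros x [Hx _]; now apply Hf. }
  split; intros H s Hs; apply Hp, H; easy.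
Qed.
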